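(* Let $n,k$ be integers with $k<n<2k$. Then exactly as follows: (1) if $k$ is odd, then $Q_{n/k}$ is a core; (2) if $n<2k-1$ and $k$ is even, then $Q_{(n-1)/(k-1)}$ is the core of $Q_{n/k}$; (3) if $n=2k-1$ and $k$ is even, then $Q_{n/k}$ is homomorphically equivalent to $Q_{(n-1)/(k-1)}$.
   Context: For positive integers $m,j$, $Q_{m/j}$ denotes the Cayley graph on $\mathbb{Z}_2^m$ (group operation bitwise XOR) whose connection set is the set of all elements of weight at least $j$; i.e. vertices are $\mathbb{Z}_2^m$ and $x\sim y$ iff $x+y$ has at least $j$ nonzero coordinates. A homomorphism $G\to H$ is an adjacency-preserving map $V(G)\to V(H)$. A graph is a core if every homomorphism from it to itself is an automorphism; the core of a graph $G$ is the (unique up to isomorphism) vertex-minimal subgraph of $G$ to which $G$ admits a homomorphism. $G$ and $H$ are homomorphically equivalent if $G\to H$ and $H\to G$. *)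

(* Defs.v *)
From mathcomp Require Import all_boot.
Set Implicit Arguments. Unset Strict Implicit. Unset Printing Implicit Defensive.

Definition Qvert (m : nat) := {ffun 'I_m -> bool}.
Definition Qadj (m j : nat) : rel (Qvert m) :=
  fun x y => j <= #|[set i : 'I_m | x i (+) y i]|.

Arguments Qadj m j : clear implicits.

Definition is_hom (V W : finType) (eV : rel V) (eW : rel W) (f : V -> W) : Prop :=
  forall x y, eV x y -> eW (f x) (f y).

Definition hom_exists (V W : finType) (eV : rel V) (eW : rel W) : Prop :=
  exists f : V -> W, is_hom eV eW f.

Definition is_aut (V : finType) (e : rel V) (f : V -> V) : Prop :=
  bijective f /\ forall x y, e (f x) (f y) = e x y.

Definition is_core (V : finType) (e : rel V) : Prop :=
  forall f : V -> V, is_hom e e f -> is_aut e f.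

Definition hom_equiv (V W : finType) (eV : rel V) (eW : rel W) : Prop :=
  hom_exists eV eW /\ hom_exists eW eV.

(* (W,eW) is (isomorphic to) the core of (V,eV): it is isomorphic to an induced
   subgraph of V (via an embedding f), V admits a homomorphism onto it, and it is
   vertex-minimal among subgraphs S of V to which V admits a homomorphism
   (a homomorphism V -> V[S] is the same as an endomorphism of V with image in S). *)
Definition is_core_of (W V : finType) (eW : rel W) (eV : rel V) : Prop :=
  [/\ (exists f : W -> V, injective f /\ forall x y, eV (f x) (f y) = eW x y),
      hom_exists eV eW
    & forall (S : {set V}) (g : V -> V),
        is_hom eV eV g -> (forall x, g x \in S) -> #|W| <= #|S| ].

(* Main.v *)
(* Let k be odd, N = n + 1 and K = k + 1.  Appending a parity bit turns an endomorphism
   f of Q_{n/k} into a map F of Z_2^N sending pairs at distance K to pairs at distance at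
   least K.  The least eigenvalue of the distance-K graph on Z_2^N is the Krawtchouk value
   K_K(1), attained only by the characters of weight 1 and N - 1 because N + 2 <= 2K.
   Summing the quadratic form of this graph over the N coordinate functions of F attains
   the spectral lower bound, so these functions are combinations of extremal characters.
   This forces F to preserve even distances, hence f is injective.  For even k the same
   extension and puncturing maps relate Q_{n/k} and Q_{(n-1)/(k-1)}. *)

From mathcomp Require Import all_boot all_order all_algebra zify ring.
Require Import Defs.

Set Implicit Arguments. Unset Strict Implicit. Unset Printing Implicit Defensive.
Import Order.TTheory GRing.Theory Num.Theory.
Local Open Scope ring_scope.

(** * Krawtchouk polynomials *)

(* The Krawtchouk value usually written K_m(j) for words of length j + i. *)
Definition kraw (m j i : nat) : int := ((1 - 'X) ^+ j * (1 + 'X) ^+ i : {poly int})`_m.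

Lemma kraw0 j i : kraw 0 j i = 1.
Proof. by rewrite /kraw -horner_coef0 !hornerE !expr1n. Qed.

Lemma kraw_plus m j i : kraw m.+1 j i.+1 = kraw m.+1 j i + kraw m j i.
Proof. by rewrite /kraw exprSr mulrA mulrDr mulr1 coefD coefMX. Qed.

Lemma kraw_minus m j i : kraw m.+1 j.+1 i = kraw m.+1 j i - kraw m j i.
Proof. by rewrite /kraw exprS -mulrA mulrBl mul1r coefB coefXM. Qed.

Lemma kraw_gt m j i : (j + i < m)%N -> kraw m j i = 0.
Proof.
elim: j i m => [|j IHj] i m; last first.
  by case: m => [//|m] ltm; rewrite kraw_minus !IHj ?subr0; lia.
elim: i m => [|i IHi] [//|m] ltm; last by rewrite kraw_plus !IHi ?addr0; lia.
by rewrite /kraw !expr0 mulr1 coef1.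
Qed.

(** The polynomial [(1 - 'X) ^+ j * (1 + 'X) ^+ i] is palindromic of degree j + i, up to the sign
    [(-1) ^+ j]. *)
Lemma kraw_rev m m' j i : (m + m' = j + i)%N -> kraw m j i = (-1) ^+ j * kraw m' j i.
Proof.
elim: j i m m' => [|j IHj] i m m'; last first.
  case: m m' => [|m] [|m'] E; rewrite ?kraw0 ?kraw_minus; try lia.
  - rewrite (kraw_gt (m := m'.+1)) ?sub0r; last by lia.
    by rewrite exprS mulN1r mulrNN -(IHj i 0%N m') ?kraw0; lia.
  - rewrite (kraw_gt (m := m.+1)) ?sub0r; last by lia.
    by rewrite exprS mulN1r mulr1 (IHj _ m 0) ?kraw0 ?mulr1; lia.
  - rewrite (IHj _ m.+1 m') ?(IHj _ m m'.+1); try lia.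
    by rewrite exprS; ring.
rewrite mul1r; elim: i m m' => [|i IHi] [|m] [|m'] E; rewrite ?kraw0 ?kraw_plus //.
- rewrite (kraw_gt (m := m'.+1)) ?add0r; last by lia.
  by rewrite -(IHi 0%N m') ?kraw0; lia.
- rewrite (kraw_gt (m := m.+1)) ?add0r; last by lia.
  by rewrite (IHi m 0%N) ?kraw0; lia.
- by rewrite (IHi m.+1 m') ?(IHi m m'.+1) 1?addrC; lia.
Qed.

(** Substituting -X for X exchanges the two factors. *)
Lemma kraw_swap m j i : kraw m j i = (-1) ^+ m * kraw m i j.
Proof.
elim: j i m => [|j IHj] i m.
  elim: i m => [|i IHi] [|m]; rewrite ?kraw0 ?mul1r //.
    by rewrite kraw_gt ?mulr0.
  by rewrite kraw_plus kraw_minus !IHi exprS; ring.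
case: m => [|m]; first by rewrite !kraw0 mul1r.
by rewrite kraw_plus kraw_minus !IHj exprS; ring.
Qed.

Lemma norm_kraw_swap m j i : `|kraw m j i| = `|kraw m i j|.
Proof. by rewrite kraw_swap normrM normrX normrN1 expr1n mul1r. Qed.

Lemma kraw_mid m j i : odd j -> (m + m = j + i)%N -> kraw m j i = 0.
Proof.
move=> oj E; have := kraw_rev E; rewrite -signr_odd oj expr1 mulN1r; lia.
Qed.

(** The value is a difference of consecutive binomials, C(i, m) - C(i, m - 1), and these increase up
    to the middle of the row. *)
Lemma kraw1_ge0 m i : (2 * m <= i.+1)%N -> 0 <= kraw m 1 i.
Proof.
elim: i m => [|i IHi] [|m] lem; rewrite ?kraw0 //; first by lia.
case: (leqP (2 * m.+1) i.+1) => [le|lt]; last by rewrite kraw_mid //; lia.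
by rewrite kraw_plus addr_ge0 ?IHi //; lia.
Qed.

Lemma kraw0_gt0 m i : (m <= i)%N -> 0 < kraw m 0 i.
Proof.
elim: i m => [|i IHi] [|m] lem; rewrite ?kraw0 //.
rewrite kraw_plus ltr_wpDl ?IHi //.
have [/IHi /ltW //|lt] := leqP m.+1 i; by rewrite kraw_gt.
Qed.

(* Pascal's rule holds for both sides, so induction on the length works except at length
   2m + 1, where one of the two terms is central; it vanishes once j is taken odd. *)
Lemma kraw_bound m j i :
  (2 * m < j.+1 + i.+1)%N -> `|kraw m j.+1 i.+1| <= kraw m 1 (j + i).+1.
Proof.
have [N] := ubnP (j + i); elim: N m j i => // N IHN [|m] j i ltN ltm.
  by rewrite !kraw0.
have step a b : (a + b <= N)%N -> (2 * m.+1 < a.+1 + b.+2)%N ->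
    (2 * m.+1).+1 = (a.+1 + b.+2)%N -> ~~ odd a ->
    `|kraw m.+1 a.+1 b.+2| <= kraw m.+1 1 (a + b.+1).+1.
  move=> le1 le2 E oa; rewrite kraw_plus (kraw_plus _ 1) (kraw_mid (j := a.+1)) //; try lia.
  rewrite (kraw_mid (j := 1)) //; try lia.
  by rewrite !add0r addnS IHN //; lia.
case: (leqP (2 * m.+1).+2 (j.+1 + i.+1)) => lt2.
  case: i => [|i] in ltN ltm lt2 *.
    by rewrite norm_kraw_swap addn0 ger0_norm ?kraw1_ge0 //; lia.
  rewrite addnS kraw_plus (kraw_plus _ 1) (le_trans (ler_normD _ _)) // lerD // IHN //; lia.
(* The length is now odd, so exactly one of the two exponents is odd; [norm_kraw_swap] moves it to
   the front if necessary. *)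
case: (boolP (odd j)) => oj; last first.
  by case: i => [|i] in ltN ltm lt2 *; [lia|apply: step => //; lia].
rewrite norm_kraw_swap addnC; case: j => [//|j] in oj ltN ltm lt2 *.
by apply: step => //; lia.
Qed.

(** Pascal's rule gives one term bounded weakly by [kraw_bound] and one bounded strictly by
    induction on m. The base is linear: [kraw 1 a b] is b - a. *)
Lemma kraw_bound_strict m j i :
  (2 * m.+1 < j.+2 + i.+1)%N -> `|kraw m.+1 j.+2 i.+2| < kraw m.+1 1 (j + i).+3.
Proof.
elim: m j i => [|m IHm] j i ltm.
  have E a b : kraw 1 a b = b%:Z - a%:Z.
    elim: a => [|a IHa]; last by rewrite kraw_minus kraw0 IHa; lia.
    by elim: b => [|b IHb]; [rewrite kraw_gt | rewrite kraw_plus kraw0 IHb; lia].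
  by rewrite !E; lia.
have step a b : (2 * m.+2 < a.+2 + b.+2)%N ->
    `|kraw m.+2 a.+2 b.+3| < kraw m.+2 1 (a + b.+1).+3.
  move=> lt; rewrite kraw_plus (kraw_plus _ 1) (le_lt_trans (ler_normD _ _)) //.
  apply: ler_ltD; first by rewrite -addSn kraw_bound //; lia.
  by rewrite addnS IHm //; lia.
case: i => [|i] in ltm *; last by apply: step; lia.
case: j => [|j] in ltm *; first by lia.
by rewrite norm_kraw_swap addnC; apply: step; lia.
Qed.

(** * Fourier analysis on the cube *)

Definition xorv N (x y : Qvert N) : Qvert N := [ffun i => x i (+) y i].
Definition wt N (x : Qvert N) : nat := (\sum_i x i)%N.
Definition chr N (J x : Qvert N) : int := \prod_i (-1) ^+ (J i && x i).
Definition ft N (u : Qvert N -> int) (J : Qvert N) : int := \sum_x u x * chr J x.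
Definition single N (l : 'I_N) : Qvert N := [ffun i => i == l].
Definition cosingle N (l : 'I_N) : Qvert N := [ffun i => i != l].

Lemma QadjE N k (x y : Qvert N) : Qadj N k x y = (k <= wt (xorv x y))%N.
Proof.
rewrite /Qadj /wt -sum1dep_card big_mkcond; congr (_ <= _)%N.
by apply: eq_bigr => i _; rewrite ffunE; case: (_ (+) _).
Qed.

Lemma wt_le N (x : Qvert N) : (wt x <= N)%N.
Proof.
rewrite -[X in (_ <= X)%N]card_ord -sum1_card; apply: leq_sum => i _.
exact: leq_b1.
Qed.

Lemma xorv_eq0 N (x y : Qvert N) : (xorv x y == [ffun=> false]) = (x == y).
Proof.
apply/eqP/eqP => [E|->]; apply/ffunP => i; last by rewrite !ffunE addbb.
by move/ffunP/(_ i): E; rewrite !ffunE; case: (x i); case: (y i).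
Qed.

Lemma xorvv N (x : Qvert N) : xorv x x = [ffun=> false].
Proof. by apply/eqP; rewrite xorv_eq0. Qed.

Lemma xorvK N (x y : Qvert N) : xorv x (xorv x y) = y.
Proof. by apply/ffunP => i; rewrite !ffunE addbA addbb. Qed.

Lemma wt_eq0 N (x : Qvert N) : (wt x == 0%N) = (x == [ffun=> false]).
Proof.
rewrite /wt sum_nat_eq0; apply/forallP/eqP => [E|-> i]; last by rewrite ffunE.
by apply/ffunP => i; rewrite ffunE; have := E i; case: (x i).
Qed.

Lemma odd_wt_xorv N (x y : Qvert N) : odd (wt (xorv x y)) = odd (wt x) (+) odd (wt y).
Proof.
rewrite /wt -oddD -big_split /=.
elim/big_ind2: _ => // [a b c d|i _]; first by rewrite !oddD => -> ->.
by rewrite ffunE; case: (x i); case: (y i).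
Qed.

Lemma chrM N (J x y : Qvert N) : chr J (xorv x y) = chr J x * chr J y.
Proof.
rewrite /chr -big_split; apply: eq_bigr => i _ /=.
by rewrite ffunE; case: (J i); case: (x i); case: (y i).
Qed.

Lemma chr_single N (l : 'I_N) x : chr (single l) x = (-1) ^+ (x l).
Proof.
rewrite /chr (bigD1 l) //= ffunE eqxx big1 ?mulr1 // => i /negPf il.
by rewrite ffunE il.
Qed.

(** The characters of [single l] and [cosingle l] multiply to the parity character, which is trivial
    on words of even weight. *)
Lemma chr_cosingle N (l : 'I_N) x : ~~ odd (wt x) -> chr (cosingle l) x = (-1) ^+ (x l).
Proof.
move=> ex; have: chr (single l) x * chr (cosingle l) x = 1.
  transitivity ((-1) ^+ wt x : int); last by rewrite -signr_odd (negPf ex).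
  rewrite /chr /wt -big_split -prodrXr; apply: eq_bigr => i _ /=; rewrite !ffunE.
  by case: (i == l); case: (x i).
by rewrite chr_single; case: (x l); rewrite ?expr0 ?expr1; lia.
Qed.

Lemma sum_chr N (x : Qvert N) :
  \sum_J chr J x = (x == [ffun=> false])%:R * 2 ^+ N.
Proof.
rewrite -(bigA_distr_bigA (fun i (b : bool) => (-1) ^+ (b && x i))) /=.
under eq_bigr => i _ do rewrite big_bool /= expr0.
have [->|/eqP nx] := eqVneq.
  rewrite mul1r -[N in RHS]card_ord -prodr_const.
  by apply: eq_bigr => i _; rewrite ffunE.
have [i xi] : exists i, x i.
  apply/existsP; apply: contra_notT nx; rewrite negb_exists => /forallP nx.
  by apply/ffunP => i; rewrite ffunE; apply/negbTE.
by rewrite (bigD1 i) //= xi expr1 addNr mul0r mul0r.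
Qed.

Lemma ft_inv N (u : Qvert N -> int) y : \sum_J ft u J * chr J y = 2 ^+ N * u y.
Proof.
under eq_bigr => J _ do rewrite /ft mulr_suml.
rewrite exchange_big /= (bigD1 y) //= [X in _ + X]big1 => [|x nxy].
  under eq_bigr => J _ do rewrite -mulrA -chrM.
  by rewrite -mulr_sumr sum_chr xorv_eq0 eqxx mul1r mulrC addr0.
under eq_bigr => J _ do rewrite -mulrA -chrM.
by rewrite -mulr_sumr sum_chr xorv_eq0 (negPf nxy) mul0r mulr0.
Qed.

(** Characters diagonalise a translation-invariant kernel, with eigenvalues [ft w J]; the factor
    [2 ^+ N] comes from the unnormalised transform. *)
Lemma ft_quad N (u w : Qvert N -> int) :
  \sum_J ft u J ^+ 2 * ft w J = 2 ^+ N * \sum_x \sum_y u x * u y * w (xorv x y).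
Proof.
transitivity (\sum_J \sum_x \sum_y u x * u y * (ft w J * chr J (xorv x y))).
  apply: eq_bigr => J _; rewrite expr2 {1 2}/ft big_distrlr /= mulr_suml.
  apply: eq_bigr => x _; rewrite mulr_suml; apply: eq_bigr => y _.
  by rewrite chrM; ring.
rewrite exchange_big mulr_sumr; apply: eq_bigr => x _.
rewrite exchange_big mulr_sumr; apply: eq_bigr => y _ /=.
by rewrite -mulr_sumr ft_inv; ring.
Qed.

Lemma wt_card N (x : Qvert N) : wt x = #|[pred i | x i]|.
Proof.
by rewrite /wt -sum1_card [RHS]big_mkcond; apply: eq_bigr => i _; rewrite inE; case: (x i).
Qed.

Lemma wtC_card N (x : Qvert N) : (N - wt x)%N = #|[pred i | ~~ x i]|.
Proof.
have := cardC [pred i | x i]; rewrite -wt_card card_ord => E.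
by rewrite -[X in (X - _)%N]E addKn.
Qed.

(** The weight generating function of a character factors over coordinates: 1 - X where [J i] holds,
    1 + X elsewhere. *)
Lemma ft_sphere N K (J : Qvert N) :
  ft (fun s => (wt s == K)%:R) J = kraw K (wt J) (N - wt J).
Proof.
pose P (s : Qvert N) : {poly int} := \prod_i ((-1) ^+ (J i && s i) * 'X ^+ s i).
have PE s : P s = (chr J s)%:P * 'X^(wt s).
  rewrite /P big_split /= (prodrXr 'X) rmorph_prod; congr (_ * _).
  by apply: eq_bigr => i _; rewrite rmorphXn rmorphN1.
have -> : ft (fun s => (wt s == K)%:R) J = (\sum_s P s)`_K.
  rewrite coef_sum; apply: eq_bigr => s _.
  by rewrite PE coefCM coefXn mulrC eq_sym.
congr (polyseq _)`_K; rewrite -(bigA_distr_bigA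
  (fun i (b : bool) => (-1) ^+ (J i && b) * 'X ^+ b)) /=.
transitivity (\prod_i (if J i then 1 - 'X else 1 + 'X : {poly int})).
  by apply: eq_bigr => i _; rewrite big_bool /=; case: (J i);
     rewrite /= !expr0 !expr1 ?mulN1r !mul1r addrC.
rewrite (bigID (fun i => J i)) /= (eq_bigr (fun=> 1 - 'X)); last by move=> i ->.
rewrite [X in _ * X](eq_bigr (fun=> 1 + 'X)); last by move=> i /negPf ->.
by rewrite !prodr_const -wt_card -wtC_card.
Qed.

(** * Sign sums and the characters of weight 1 and N - 1 *)

Lemma sum_sign N (x : Qvert N) : \sum_i (-1) ^+ (x i) = N%:Z - (2 * wt x)%:Z.
Proof.
have -> : N%:Z = \sum_(i < N) 1 by rewrite sumr_const card_ord; lia.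
rewrite PoszM -[(wt x)%:Z]natz natr_sum mulr_sumr -sumrB; apply: eq_bigr => i _.
by case: (x i).
Qed.

Lemma wt_single N (l : 'I_N) : wt (single l) = 1%N.
Proof.
rewrite /wt (bigD1 l) //= ffunE eqxx big1 // => i /negPf il.
by rewrite ffunE il.
Qed.

Lemma wt_cosingle N (l : 'I_N) : wt (cosingle l) = N.-1.
Proof.
suff: (wt (single l) + wt (cosingle l) = N)%N by rewrite wt_single; lia.
rewrite /wt -big_split /= -[RHS]card_ord -sum1_card; apply: eq_bigr => i _.
by rewrite !ffunE; case: (i == l).
Qed.

Lemma wt1P N (J : Qvert N) : wt J = 1%N -> exists l, J = single l.
Proof.
move=> E; have /existsP [l Jl] : [exists l, J l].
  apply: contraT; rewrite negb_exists => /forallP nJ.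
  by move: E; rewrite /wt big1 // => i _; rewrite (negPf (nJ i)).
exists l; apply/ffunP => i; rewrite ffunE.
have [->|il] := eqVneq; first exact: Jl.
move: E; rewrite /wt (bigD1 l) //= (bigD1 i) //= Jl; case: (J i) => //; lia.
Qed.

Lemma wtN1P N (J : Qvert N) : (0 < N)%N -> wt J = N.-1 -> exists l, J = cosingle l.
Proof.
move=> N0 E; pose J' : Qvert N := [ffun i => ~~ J i].
have : (wt J + wt J' = N)%N.
  rewrite /wt -big_split /= -[RHS]card_ord -sum1_card; apply: eq_bigr => i _.
  by rewrite !ffunE; case: (J i).
move=> E'; have /wt1P [l /ffunP El] : wt J' = 1%N by lia.
by exists l; apply/ffunP => i; have := El i; rewrite !ffunE => <-; rewrite negbK.
Qed.

Lemma single_inj N : injective (@single N).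
Proof. by move=> i j /ffunP/(_ i); rewrite !ffunE eqxx => /esym/eqP. Qed.

Lemma cosingle_inj N : injective (@cosingle N).
Proof. by move=> i j /ffunP/(_ i); rewrite !ffunE eqxx => /esym/negbFE/eqP. Qed.

(** The bound [2 < N] separates the weights 1 and N - 1, so no character is counted twice. *)
Lemma sum_single_cosingle N (G : Qvert N -> int) : (2 < N)%N ->
    (forall J, wt J != 1%N -> wt J != N.-1 -> G J = 0) ->
  \sum_J G J = \sum_l (G (single l) + G (cosingle l)).
Proof.
move=> N2 G0; have codE (h : 'I_N -> Qvert N) : injective h ->
    \sum_l G (h l) = \sum_(J | J \in codom h) G J.
  move=> h_inj; rewrite -big_uniq; last exact/injectiveP.
  by rewrite /= big_image.
rewrite big_split /= (codE _ (@single_inj N)) (codE _ (@cosingle_inj N)).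
rewrite (bigID (fun J => J \in codom (@single N))) /=; congr (_ + _).
rewrite (bigID (fun J => J \in codom (@cosingle N))) /= [X in _ + X]big1 ?addr0.
  apply: eq_bigl => J; apply: andb_idl => /codomP [l ->].
  apply/negP => /codomP [l' /(congr1 (@wt N))].
  by rewrite wt_single wt_cosingle; lia.
move=> J /andP [nJ nJ']; apply: G0; [apply: contra nJ|apply: contra nJ'].
  by move=> /eqP /wt1P [l ->]; apply: codom_f.
by move=> /eqP /wtN1P [|l ->]; [lia|apply: codom_f].
Qed.

Lemma exists_wt N K (i l : 'I_N) : i != l -> (0 < K < N)%N ->
  exists A : {set 'I_N}, [/\ i \notin A, l \notin A & #|A| = K.-1].
Proof.
move=> il /andP [K0 KN].
have : (0 < #|[set A : {set 'I_N} | A \subset ~: [set i; l] & #|A| == K.-1]|)%N.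
  by rewrite cards_draws bin_gt0 cardsCs setCK card_ord cards2 il; lia.
move=> /card_gt0P [A]; rewrite inE => /andP [sA /eqP cA]; exists A.
by split=> //; apply/negP => /(subsetP sA); rewrite !inE eqxx ?orbT.
Qed.

(** Comparing two words of weight K that differ by exchanging i and l gives [c i = c l]. A constant
    c then satisfies c (N - 2K) = 0. *)
Lemma linear_vanish N K (c : 'I_N -> int) : (0 < K < N)%N -> N != (2 * K)%N ->
    (forall t : Qvert N, wt t = K -> \sum_l c l * (-1) ^+ (t l) = 0) ->
  forall l, c l = 0.
Proof.
move=> hK NK H.
have wt_set (B : {set 'I_N}) : wt ([ffun x => x \in B] : Qvert N) = #|B|.
  by rewrite wt_card; apply: eq_card => x; rewrite !inE ffunE.
have EK : (true + K.-1)%N = K by lia.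
have ceq i l : c i = c l.
  have [->//|il] := eqVneq i l; have [A [iA lA cA]] := exists_wt il hK.
  have := H [ffun x => x \in i |: A]; rewrite wt_set cardsU1 iA cA => /(_ EK).
  have := H [ffun x => x \in l |: A]; rewrite wt_set cardsU1 lA cA => /(_ EK).
  rewrite (bigD1 i) // (bigD1 l) 1?eq_sym //= !ffunE !inE eqxx (negPf il) (negPf iA).
  under eq_bigr => x /andP [xi xl] do rewrite ffunE !inE (negPf xl) /=.
  move=> E1.
  rewrite (bigD1 i) // (bigD1 l) 1?eq_sym //= !ffunE !inE eqxx eq_sym (negPf il) (negPf lA).
  under eq_bigr => x /andP [xi xl] do rewrite ffunE !inE (negPf xi) /=.
  by move: E1; rewrite /= !expr1 !expr0; set S := \sum_(x < N | _) _; lia.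
move=> l; have [A sA] : exists A : {set 'I_N}, #|A| = K.
  have : (0 < #|[set A : {set 'I_N} | A \subset setT & #|A| == K]|)%N.
    by rewrite cards_draws bin_gt0 cardsT card_ord; lia.
  by move=> /card_gt0P [A]; rewrite inE => /andP [_ /eqP]; exists A.
have := H _ (etrans (wt_set A) sA).
under eq_bigr => x _ do rewrite (ceq x l).
by rewrite -mulr_sumr sum_sign wt_set sA => /eqP; rewrite mulf_eq0 => /orP [/eqP //|]; lia.
Qed.

(** * The distance-K graph *)

Definition sgn N (i : 'I_N) (x : Qvert N) : int := (-1) ^+ (x i).

Lemma sum_sgnM N (x y : Qvert N) :
  \sum_i sgn i x * sgn i y = N%:Z - (2 * wt (xorv x y))%:Z.
Proof.
by rewrite -sum_sign; apply: eq_bigr => i _; rewrite ffunE signr_addb.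
Qed.

Section Sphere.
Variables N K : nat.
Hypotheses (evK : ~~ odd K) (KN : (K < N)%N) (NK : (N.+2 <= 2 * K)%N).

Let lmin : int := kraw K 1 N.-1.
(* Its Fourier transform is the spectrum of the distance-K graph shifted by the least
   eigenvalue, hence nonnegative. *)
Definition wgt (s : Qvert N) : int := (wt s == K)%:R - lmin * (s == [ffun=> false])%:R.

Lemma ft_wgt J : ft wgt J = kraw K (wt J) (N - wt J) - lmin.
Proof.
have E : \sum_x (x == [ffun=> false])%:R * chr J x = 1.
  rewrite (bigD1 [ffun=> false]) //= eqxx mul1r big1 ?addr0; last first.
    by move=> x /negPf ->; rewrite mul0r.
  by rewrite /chr big1 // => i _; rewrite ffunE andbF.
rewrite -ft_sphere /ft -[lmin]mulr1 -[X in lmin * X]E mulr_sumr -sumrB.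
by apply: eq_bigr => x _; rewrite /wgt mulrBl mulrA.
Qed.

(** Moves the degree to N - K, in the lower half of the range, where the Krawtchouk bounds apply. *)
Lemma kraw_sphere j i : (j + i = N)%N -> kraw K j i = (-1) ^+ j * kraw (N - K) j i.
Proof. by move=> E; apply: kraw_rev; lia. Qed.

Lemma lminE : lmin = - kraw (N - K) 1 N.-1.
Proof. by rewrite /lmin kraw_sphere ?expr1 ?mulN1r //; lia. Qed.

Lemma kraw_sphere_swap j i : kraw K j i = kraw K i j.
Proof. by rewrite kraw_swap -signr_odd (negPf evK) mul1r. Qed.

(** At weights 0 and N the eigenvalue is a positive binomial while [lmin] is at most 0. In between,
    [kraw_bound_strict] separates the two. *)
Lemma ft_wgt_gt0 J : wt J != 1%N -> wt J != N.-1 -> 0 < ft wgt J.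
Proof.
move=> n1 nN; have leJ := wt_le J; rewrite ft_wgt subr_gt0.
have lmin_le0 : lmin <= 0 by rewrite lminE oppr_le0 kraw1_ge0 //; lia.
have [J0|J0] := eqVneq (wt J) 0%N.
  by rewrite J0 subn0 (le_lt_trans lmin_le0) // kraw0_gt0 // ltnW.
have [JN|JN] := eqVneq (wt J) N.
  by rewrite JN subnn kraw_sphere_swap (le_lt_trans lmin_le0) // kraw0_gt0 // ltnW.
have [j Ej] : exists j, wt J = j.+2 by exists (wt J).-2; lia.
have [i Ei] : exists i, (N - wt J)%N = i.+2 by exists (N - wt J).-2; lia.
have [m Em] : exists m, (N - K)%N = m.+1 by exists (N - K).-1; lia.
rewrite lminE Ei Ej kraw_sphere; last by lia.
have := @kraw_bound_strict m j i; rewrite Em.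
have -> : (j + i).+3 = N.-1 by lia.
move=> /(_ ltac:(lia)); rewrite ltr_norml -signr_odd => /andP [lt1 lt2].
by case: (odd _); rewrite ?expr1 ?mulN1r ?mul1r // ltrN2.
Qed.

Lemma ft_wgt_single l : ft wgt (single l) = 0.
Proof. by rewrite ft_wgt wt_single subn1 subrr. Qed.

(** For even K the eigenvalues at weights 1 and N - 1 coincide. *)
Lemma ft_wgt_cosingle l : ft wgt (cosingle l) = 0.
Proof.
have N0 : (0 < N)%N by lia.
rewrite ft_wgt wt_cosingle kraw_sphere_swap; have -> : (N - N.-1)%N = 1%N by lia.
by rewrite subrr.
Qed.

Lemma ft_wgt_ge0 J : 0 <= ft wgt J.
Proof.
have [/wt1P [l ->]|n1] := eqVneq (wt J) 1%N; first by rewrite ft_wgt_single.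
have [/wtN1P [|l ->]|nN] := eqVneq (wt J) N.-1; [by lia|by rewrite ft_wgt_cosingle|].
exact/ltW/ft_wgt_gt0.
Qed.

(* The coordinate functions themselves are extremal. *)
Lemma sum_dot_wgt x : \sum_y (N%:Z - (2 * wt (xorv x y))%:Z) * wgt (xorv x y) = 0.
Proof.
rewrite (reindex_inj (can_inj (xorvK x))) /=.
under eq_bigr => y _ do rewrite xorvK -sum_sign mulr_suml.
rewrite exchange_big big1 // => l _ /=; transitivity (ft wgt (single l)).
  by apply: eq_bigr => y _; rewrite chr_single mulrC.
exact: ft_wgt_single.
Qed.

(** * Maps under which pairs at distance K end up at distance at least K *)

Section Map.
Variable F : Qvert N -> Qvert N.
Hypothesis F_hom : forall x y, wt (xorv x y) = K -> (K <= wt (xorv (F x) (F y)))%N.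

Let dot x y := N%:Z - (2 * wt (xorv (F x) (F y)))%:Z.
Let u (i : 'I_N) x := sgn i (F x).

(** On the diagonal both inner products are N. Off it the weight is supported on distance K, where
    [F_hom] lowers the inner product. *)
Lemma dot_le x y : dot x y * wgt (xorv x y) <=
  (N%:Z - (2 * wt (xorv x y))%:Z) * wgt (xorv x y).
Proof.
rewrite /wgt /dot; have [/eqP|nxy] := eqVneq (xorv x y) [ffun=> false].
  by rewrite xorv_eq0 => /eqP ->; rewrite !xorvv.
rewrite mulr0 subr0; have [E|_] := eqVneq; last by rewrite !mulr0.
by rewrite !mulr1; have := F_hom E; rewrite E; lia.
Qed.

Lemma sum_ft_wgt : \sum_i \sum_J ft (u i) J ^+ 2 * ft wgt J =
  2 ^+ N * \sum_x \sum_y dot x y * wgt (xorv x y).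
Proof.
under eq_bigr => i _ do rewrite ft_quad.
rewrite -mulr_sumr exchange_big /=; congr (_ * _); apply: eq_bigr => x _.
rewrite exchange_big; apply: eq_bigr => y _ /=.
by rewrite -mulr_suml sum_sgnM.
Qed.

Lemma sum_dot_le0 : \sum_x \sum_y dot x y * wgt (xorv x y) <= 0.
Proof.
apply: sumr_le0 => x _; rewrite -[leRHS](sum_dot_wgt x).
by apply: ler_sum => y _; apply: dot_le.
Qed.

Lemma sum_ft_wgt_ge0 : 0 <= \sum_i \sum_J ft (u i) J ^+ 2 * ft wgt J.
Proof.
by do 2![apply: sumr_ge0 => ? _]; rewrite mulr_ge0 ?sqr_ge0 ?ft_wgt_ge0.
Qed.

(** The form is at most 0 by comparison with the identity map, and at least 0 because its spectrum
    is nonnegative. *)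
Lemma sum_dot0 : \sum_x \sum_y dot x y * wgt (xorv x y) = 0.
Proof.
apply/eqP; rewrite eq_le sum_dot_le0; have := sum_ft_wgt_ge0.
by rewrite sum_ft_wgt pmulr_rge0 // exprn_gt0.
Qed.

Lemma ft_supp i J : wt J != 1%N -> wt J != N.-1 -> ft (u i) J = 0.
Proof.
move=> n1 nN; have /eqP := sum_ft_wgt; rewrite sum_dot0 mulr0.
have ge0 i' J' : 0 <= ft (u i') J' ^+ 2 * ft wgt J'.
  by rewrite mulr_ge0 ?sqr_ge0 ?ft_wgt_ge0.
rewrite psumr_eq0 => [/allP /(_ i)|i' _]; last exact: sumr_ge0.
rewrite mem_index_enum psumr_eq0 //= => /(_ isT) /allP /(_ J).
rewrite mem_index_enum /= => /(_ isT).
by rewrite mulf_eq0 sqrf_eq0 (gt_eqF (ft_wgt_gt0 n1 nN)) orbF => /eqP.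
Qed.

(** The total slack in [dot_le] is zero, so every single inequality is an equality. *)
Lemma dist_sphere x y : wt (xorv x y) = K -> wt (xorv (F x) (F y)) = K.
Proof.
move=> E; pose e (x y : Qvert N) := N%:Z - (2 * wt (xorv x y))%:Z : int.
have : \sum_x \sum_y (e x y * wgt (xorv x y) - dot x y * wgt (xorv x y)) = 0.
  under eq_bigr => z _ do rewrite sumrB sum_dot_wgt.
  by rewrite sumrB sum_dot0 big1 ?subr0.
have ge0 x' y' : 0 <= e x' y' * wgt (xorv x' y') - dot x' y' * wgt (xorv x' y').
  by rewrite subr_ge0 dot_le.
move/eqP; rewrite psumr_eq0 => [/allP /(_ x)|i' _]; last exact: sumr_ge0.
rewrite mem_index_enum psumr_eq0 //= => /(_ isT) /allP /(_ y).
rewrite mem_index_enum /= => /(_ isT).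
have nxy : (xorv x y == [ffun=> false]) = false by rewrite -wt_eq0 E; lia.
rewrite /wgt E eqxx nxy mulr0 subr0 !mulr1 /e /dot E; lia.
Qed.
End Map.

(** The change h in inner product with a fixed x has only extremal Fourier coefficients, so on even
    translates it is linear in signs. It vanishes on the sphere of radius K, which determines such a
    form. *)
Lemma hom_even_isometry (F : Qvert N -> Qvert N) :
  (forall x y, wt (xorv x y) = K -> (K <= wt (xorv (F x) (F y)))%N) ->
  forall x y, ~~ odd (wt (xorv x y)) -> wt (xorv (F x) (F y)) = wt (xorv x y).
Proof.
move=> F_hom x y ev.
pose h z : int := \sum_i (sgn i (F x) * sgn i (F z) - sgn i x * sgn i z).
have hE z : h z = (2 * wt (xorv x z))%:Z - (2 * wt (xorv (F x) (F z)))%:Z.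
  by rewrite /h sumrB !sum_sgnM; lia.
suff: h y = 0 by rewrite hE; lia.
have h_supp J : wt J != 1%N -> wt J != N.-1 -> ft h J = 0.
  move=> n1 nN; rewrite /ft /h; under eq_bigr => z _ do rewrite mulr_suml.
  rewrite exchange_big big1 // => i _ /=.
  under eq_bigr => z _ do rewrite mulrBl -!mulrA.
  rewrite sumrB -!mulr_sumr.
  have -> : \sum_z sgn i (F z) * chr J z = 0 by apply: ft_supp.
  (* The identity also satisfies the hypothesis on [F]. *)
  have -> : \sum_z sgn i z * chr J z = 0.
    by apply: (@ft_supp id) => // z t ->.
  by rewrite !mulr0 subr0.
(* On even words [single l] and [cosingle l] give the same character, so their coefficients merge;
   the values at x absorb the translation. *)
pose c l := ft h (single l) * chr (single l) x + ft h (cosingle l) * chr (cosingle l) x.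
have hc t : ~~ odd (wt t) -> 2 ^+ N * h (xorv x t) = \sum_l c l * (-1) ^+ (t l).
  move=> evt; rewrite -ft_inv sum_single_cosingle; last first.
  - by move=> J n1 nN; rewrite h_supp ?mul0r.
  - by lia.
  apply: eq_bigr => l _; rewrite !chrM (chr_cosingle _ evt) /c.
  by rewrite !chr_single mulrDl !mulrA.
have c0 : forall l, c l = 0.
  apply: (@linear_vanish N K) => [||t Et]; [lia|lia|].
  rewrite -hc ?Et // hE.
  by rewrite (dist_sphere F_hom) ?xorvK ?Et // subrr mulr0.
have := hc _ ev; rewrite xorvK big1 => [/eqP|l _]; last by rewrite c0 mul0r.
by rewrite mulf_eq0 expf_eq0 /= andbF => /eqP.
Qed.
End Sphere.

Local Close Scope ring_scope.

(** * Extending and puncturing *)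

(** The parity bit sits at [ord0]; the image lies in the even-weight words. *)
Definition extend n (x : Qvert n) : Qvert n.+1 :=
  [ffun i => if unlift ord0 i is Some j then x j else odd (wt x)].

Definition puncture n (z : Qvert n.+1) : Qvert n := [ffun i => z (lift ord0 i)].

Lemma extendK n : cancel (@extend n) (@puncture n).
Proof. by move=> x; apply/ffunP => i; rewrite !ffunE liftK. Qed.

Lemma xorv_extend n (x y : Qvert n) : xorv (extend x) (extend y) = extend (xorv x y).
Proof.
apply/ffunP => i; rewrite !ffunE; case: unliftP => [j _|_]; first by rewrite ffunE.
by rewrite odd_wt_xorv.
Qed.

Lemma xorv_puncture n (x y : Qvert n.+1) :
  xorv (puncture x) (puncture y) = puncture (xorv x y).
Proof. by apply/ffunP => i; rewrite !ffunE. Qed.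

Lemma wt_puncture n (z : Qvert n.+1) : wt z = z ord0 + wt (puncture z).
Proof.
by rewrite /wt big_ord_recl; congr (_ + _); apply: eq_bigr => i _; rewrite ffunE.
Qed.

Lemma wt_extend n (x : Qvert n) : wt (extend x) = odd (wt x) + wt x.
Proof. by rewrite wt_puncture extendK ffunE unlift_none. Qed.

Lemma odd_wt_extend n (x : Qvert n) : ~~ odd (wt (extend x)).
Proof. by rewrite wt_extend oddD oddb addbb. Qed.

(** For odd k, a pair at distance exactly k differs in parity and gains one; larger distances
    already reach k + 1. *)
Lemma extend_hom n k : odd k -> is_hom (Qadj n k) (Qadj n.+1 k.+1) (@extend n).
Proof.
move=> ok x y; rewrite !QadjE xorv_extend wt_extend leq_eqVlt => /predU1P [<-|].
  by rewrite ok.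
by move=> lt; rewrite (leq_trans lt) ?leq_addl.
Qed.

Lemma puncture_hom n k : is_hom (Qadj n.+1 k.+1) (Qadj n k) (@puncture n).
Proof.
move=> x y; rewrite !QadjE xorv_puncture wt_puncture.
by case: (xorv x y ord0) => // /ltnW.
Qed.

Lemma inj_hom_aut (V : finType) (e : rel V) (f : V -> V) :
  injective f -> is_hom e e f -> is_aut e f.
Proof.
move=> f_inj f_hom; split=> [|x y]; first exact: injF_bij.
pose E : {set V * V} := [set p | e p.1 p.2].
pose g (p : V * V) := (f p.1, f p.2).
have g_inj : injective g by move=> [a b] [c d] [/f_inj -> /f_inj ->].
(* An injection of the finite edge set into itself is onto, so no non-edge can be mapped to an
   edge. *)
have /eqP gE : g @: E == E.
  rewrite eqEcard card_imset // leqnn andbT.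
  by apply/subsetP => _ /imsetP [p pE ->]; move: pE; rewrite !inE; apply: f_hom.
by have := mem_imset E (x, y) g_inj; rewrite gE !inE.
Qed.

Lemma Q_odd_core n k : k < n -> n < 2 * k -> odd k -> is_core (Qadj n k).
Proof.
move=> kn nk ok f f_hom; apply: inj_hom_aut => // x y fxy.
(* Distance k + 1 drops to at least k after puncturing, [f] preserves adjacency, and the parity bit
   restores k + 1. *)
pose F z := extend (f (puncture z)).
have F_hom z t : wt (xorv z t) = k.+1 -> k.+1 <= wt (xorv (F z) (F t)).
  move=> E; have := extend_hom ok (f_hom _ _ (@puncture_hom n k z t _)).
  by rewrite !QadjE E => ->.
(* Extended words are at even distance, so equal images under [f] force their distance to be 0. *)
have := @hom_even_isometry n.+1 k.+1 _ _ _ F F_hom (extend x) (extend y).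
rewrite xorv_extend odd_wt_extend /F !extendK fxy xorvv => /(_ _ _ _ isT) E.
apply: (can_inj (@extendK n)); apply/eqP; rewrite -xorv_eq0 -wt_eq0 xorv_extend.
rewrite -E; [|by rewrite /= ok|lia|lia].
by rewrite wt_eq0.
Qed.

Theorem theorem4p14 (n k : nat) :
  k < n -> n < 2 * k ->
  [/\ odd k -> is_core (Qadj n k),
      n < 2 * k - 1 -> ~~ odd k -> is_core_of (Qadj (n - 1) (k - 1)) (Qadj n k)
    & n = 2 * k - 1 -> ~~ odd k -> hom_equiv (Qadj n k) (Qadj (n - 1) (k - 1))].
Proof.
move=> kn nk; split; first exact: Q_odd_core.
- case: k kn nk => [|k]; first by lia.
  case: n => [|n]; first by lia.
  rewrite !subn1 /= negbK => kn nk nk2 ok; split.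
  + exists (@extend n); split=> [|x y]; first exact: can_inj (@extendK n).
    apply/idP/idP => [/puncture_hom|/(extend_hom ok)] //.
    by rewrite !extendK.
  + by exists (@puncture n); apply: puncture_hom.
  move=> S g g_hom gS.
  (* In the shifted parameters the strict bound of the second case reads n < 2k, as the odd case
     requires. The composite is an endomorphism of the smaller graph. *)
  have [] := @Q_odd_core n k _ _ ok (@puncture n \o g \o @extend n).
  - by lia.
  - by lia.
  - move=> x y xy; apply/puncture_hom/g_hom/extend_hom => //.
  (* Injectivity of the composite passes to [g \o @extend n], which embeds the smaller vertex set in
     [S]. *)
  move=> /bij_inj h_inj _.
  have ge_inj : injective (g \o @extend n).
    by move=> x y E; apply: h_inj; rewrite /= [g _]E.
  rewrite -(card_imset _ ge_inj); apply: subset_leq_card.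
  by apply/subsetP => _ /imsetP [x _ ->]; apply: gS.
- case: k kn nk => [|k]; first by lia.
  case: n => [|n]; first by lia.
  rewrite !subn1 /= negbK => kn nk _ ok; split.
    by exists (@puncture n); apply: puncture_hom.
  by exists (@extend n); apply: extend_hom.
Qed.
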